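(* Let $N\ge 3$ and let $G$ be a finite digraph. Then $$\Omega_3^N=\Omega_3^{N,1}\cap\Omega_3^{N,2}.$$ Equivalently, $\Omega_3^N$ is generated by the generators of $\Omega_3^{N,2}\cap\Omega_3^{N,1}$, i.e. by the minimal clusters of $\Omega_3^{N,2}\cap\Omega_3^{N,1}$, for each of which the image-types of all components belong to one of the groups $T_1=(\gamma_1,\gamma_4,\gamma_7)$, $T_2=(\gamma_2,\gamma_5,\gamma_7,\gamma_8)$, $T_3=(\gamma_3,\gamma_6,\gamma_7)$, $T_4=(\gamma_7)$, $T_5=(\gamma_9)$.
   Context: A digraph $G=(V,E)$ is finite and simple: $V$ is finite, $E\subset V\times V$, no loops and no multiple edges (both $(i,j)$ and $(j,i)$ may be edges). Fix $N$ and a primitive $N$-th root of unity $\xi\in\mathbb{C}$. An elementary $p$-path is a sequence of $p+1$ vertices, written $e_{i_0,\dots,i_p}$; it is regular if consecutive vertices are different and irregular otherwise. It is allowed if $(i_k,i_{k+1})\in E$ for all $k$ (every vertex is an allowed $0$-path). $\mathcal{A}_n$ is the $\mathbb{C}$-vector space with basis the allowed elementary $n$-paths, with $\mathcal{A}_n=0$ for $n<0$. The regular boundary operator is $\partial(e_{i_0,\dots,i_p})=\sum_{j=0}^p \xi^j e_{i_0,\dots,\widehat{i_j},\dots,i_p}$, where irregular paths on the right are replaced by $0$, and $\partial=0$ on $0$-paths. For $1\le q\le N-1$, $\Omega_n^{N,q}=\{v\in\mathcal{A}_n\mid \partial^q v\in\mathcal{A}_{n-q}\}$, and $\Omega_n^N=\bigcap_{1\le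 q\le N-1}\Omega_n^{N,q}$. A $3$-path $w\in\mathcal{A}_3$ is a cluster if all elementary paths occurring in it with nonzero coefficient (its components) have the same first vertex and the same last vertex. A nonzero $w\in\Omega_3^{N,2}\cap\Omega_3^{N,1}$ is minimal if no nonempty proper subset of its components has a nonzero linear combination lying in $\Omega_3^{N,2}\cap\Omega_3^{N,1}$. Type of a $2$-path $e_{x,y,z}$: $T$ if it is allowed and $(x,z)\in E$ or $x=z$; $S$ if it is allowed, $x\ne z$, $(x,z)\notin E$, and there is $y'\neq y$ with $e_{x,y',z}$ allowed; $W$ if it is allowed, $x\neq z$, $(x,z)\notin E$, and it is the only allowed $2$-path from $x$ to $z$; $N_w$ if it is not allowed. Irregular faces $e_{x,x,z}$ or $e_{x,z,z}$ of an allowed $3$-path (for which $(x,z)\in E$) are counted as type $T$. The image-type of an allowed $3$-path $e_{i,j,k,l}$ is the quadruple of types of $(e_{j,k,l},e_{i,k,l},e_{i,j,l},e_{i,j,k})$. Notation: $\gamma_1=(S,T,N_w,T)$, $\gamma_2=(S,S,N_w,T)$, $\gamma_3=(S,W,N_w,T)$, $\gamma_4=(T,N_w,T,S)$, $\gamma_5=(T,N_w,S,S)$, $\gamma_6=(T,N_w,W,S)$, $\gamma_7=(S,N_w,N_w,S)$, $\gamma_8=(T,S,S,T)$, $\gamma_9=(T,T,T,T)$. *)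

(* Defs.v *)
From HB Require Import structures.
From mathcomp Require Import all_boot all_order all_algebra.
From mathcomp Require Import finmap.
From mathcomp Require Import boolp classical_sets reals.
From mathcomp Require Import complex monalg.

Set Implicit Arguments.
Unset Strict Implicit.
Unset Printing Implicit Defensive.

Import Order.TTheory GRing.Theory Num.Theory.

Local Open Scope classical_set_scope.
Local Open Scope ring_scope.

(* The complex numbers are R[i] for R : realType. A digraph is a finType V of
   vertices with an irreflexive edge relation E.

   The elementary p-path e_{i_0,...,i_p} is the sequence [:: i_0; ...; i_p] of
   its p+1 vertices, and a chain is a formal C-linear combination of sequences;
   v@_s is the coefficient of e_s in v and msupp v is the set of its
   components. *)

Section Paths.
Variables (R : realType) (V : finType).

Local Notation C := R[i].
Local Notation chain := {malg C[seq V]}.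

Definition regular_path (s : seq V) : bool := sorted [rel x y | x != y] s.

Definition delete_at (j : nat) (s : seq V) : seq V := take j s ++ drop j.+1 s.

(* The regular boundary. The bound on the size kills the 0-paths (and the empty
   sequence, which is not a path of any degree). *)
Definition bd_path (xi : C) (s : seq V) : chain :=
  if (size s <= 1)%N then 0
  else \sum_(j < size s)
         (if regular_path (delete_at j s)
          then << xi ^+ j *g delete_at j s >> else 0).

Definition bd (xi : C) (v : chain) : chain :=
  \sum_(s <- msupp v) v@_s *: bd_path xi s.

Variable E : rel V.

Definition allowed_path (n : int) (s : seq V) : bool :=
  [&& s != [::], (size s)%:Z == n + 1 & sorted E s].

(* For n < 0 no sequence satisfies [allowed_path n], so A n is {0}. *)
Definition A (n : int) : set chain :=
  [set v | forall s, s \in msupp v -> allowed_path n s].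

(* Omega_n^{N,q}; the integer N enters only through the N-th root xi. *)
Definition Omegaq (xi : C) (n : int) (q : nat) : set chain :=
  [set v | A n v /\ A (n - q%:Z) (iter q (bd xi) v)].

Definition Omega (xi : C) (N : nat) (n : int) : set chain :=
  \bigcap_(q in [set q | (1 <= q <= N - 1)%N]) Omegaq xi n q.

Definition Omega21 (xi : C) : set chain := Omegaq xi 3 2 `&` Omegaq xi 3 1.

Definition cluster (w : chain) : Prop :=
  A 3 w /\
  forall i j k l i' j' k' l' : V,
    [:: i; j; k; l] \in msupp w -> [:: i'; j'; k'; l'] \in msupp w ->
    i = i' /\ l = l'.

Definition minimal (xi : C) (w : chain) : Prop :=
  [/\ Omega21 xi w, w != 0 &
      forall P : {fset seq V}, P != fset0 -> (P `<` msupp w)%fset ->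
        ~ exists v : chain, [/\ (msupp v `<=` P)%fset, v != 0 & Omega21 xi v]].

Definition minimal_cluster (xi : C) (w : chain) : Prop :=
  cluster w /\ minimal xi w.

End Paths.

Definition linear_span (K : pzRingType) (M : lmodType K) (X : set M) : set M :=
  [set v | exists (m : nat) (c : 'I_m -> K) (x : 'I_m -> M),
     (forall i, X (x i)) /\ v = \sum_(i < m) c i *: x i].

Inductive path_type : Set := typeT | typeS | typeW | typeNw.

(* The first test covers the irregular faces e_{x,x,z} and e_{x,z,z} of an
   allowed 3-path, which are not allowed but count as T. *)
Definition type2 (V : finType) (E : rel V) (x y z : V) : path_type :=
  if (x == y) || (y == z) then typeT
  else if ~~ (E x y && E y z) then typeNw
  else if E x z || (x == z) then typeT
  else if [exists y', [&& y' != y, E x y' & E y' z]] then typeS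
  else typeW.

Definition image_type_t : Set := path_type * path_type * path_type * path_type.

Definition image_type (V : finType) (E : rel V) (i j k l : V) : image_type_t :=
  (type2 E j k l, type2 E i k l, type2 E i j l, type2 E i j k).

Definition gamma1 : image_type_t := (typeS, typeT, typeNw, typeT).
Definition gamma2 : image_type_t := (typeS, typeS, typeNw, typeT).
Definition gamma3 : image_type_t := (typeS, typeW, typeNw, typeT).
Definition gamma4 : image_type_t := (typeT, typeNw, typeT, typeS).
Definition gamma5 : image_type_t := (typeT, typeNw, typeS, typeS).
Definition gamma6 : image_type_t := (typeT, typeNw, typeW, typeS).
Definition gamma7 : image_type_t := (typeS, typeNw, typeNw, typeS).
Definition gamma8 : image_type_t := (typeT, typeS, typeS, typeT).
Definition gamma9 : image_type_t := (typeT, typeT, typeT, typeT).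

Definition group1 : set image_type_t := [set gamma1; gamma4; gamma7].
Definition group2 : set image_type_t := [set gamma2; gamma5; gamma7; gamma8].
Definition group3 : set image_type_t := [set gamma3; gamma6; gamma7].
Definition group4 : set image_type_t := [set gamma7].
Definition group5 : set image_type_t := [set gamma9].

Definition type_groups : set (set image_type_t) :=
  [set group1; group2; group3; group4; group5].

(* Main.v *)
(* Write a 3-chain with fixed end vertices a, c as a matrix indexed by its two middle
   vertices. It lies in Omega^{3,1} and Omega^{3,2} iff every row and every column whose
   face is of type N_w sums to zero, and so does the whole matrix when a <> c and
   a -/-> c; the factor 1 + xi is nonzero because N >= 3. Higher powers of the boundary
   give no condition, as every vertex is allowed. The conditions are linear and
   separate over the end vertices, so chains split into clusters and these into minimal
   ones. A row or column
   summing to zero has no single nonzero entry, so the first and last faces of a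
   component have type T or S. If a -> c or a = c, an
   entry in a free row and a free column is by itself a minimal cluster of type gamma9;
   otherwise the free rows and the free columns are both indexed by the intermediate
   vertices from a to c, and the group depends on their number. *)
Require Import Defs.
From mathcomp Require Import all_boot all_order all_algebra.
From mathcomp Require Import finmap zify.
From mathcomp Require Import boolp classical_sets reals.
From mathcomp Require Import complex monalg.

Set Implicit Arguments.
Unset Strict Implicit.
Unset Printing Implicit Defensive.

Import Order.TTheory GRing.Theory Num.Theory.

Local Open Scope classical_set_scope.
Local Open Scope ring_scope.

(** * Coefficients of the boundary of a chain *)

Section Boundary.
Variables (R : realType) (V : finType).
Implicit Types (xi : R[i]) (s t : seq V) (v w : {malg R[i][seq V]}).

Definition insert_at (j : nat) (a : V) (t : seq V) : seq V :=
  take j t ++ a :: drop j t.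

(** Trades a test on a deletion for a sum over insertions, so that a boundary coefficient can be
    indexed by the face [t]. At most one vertex [a] contributes, namely the one removed from [s]. *)
Lemma delete_at_eq j s t : (j < size s)%N ->
  (delete_at j s == t)%:R =
    (j <= size t)%N%:R * \sum_(a : V) (s == insert_at j a t)%:R :> R[i].
Proof.
move=> js.
have [x0 _] : exists x0 : V, x0 \in s by case: s js => // x s _; exists x; rewrite inE eqxx.
have [<-|ne] := eqVneq (delete_at j s) t.
  have tj : size (take j s) = j by rewrite size_take js.
  rewrite size_cat tj leq_addr mul1r (bigD1 (nth x0 s j)) //= big1 ?addr0.
    rewrite /insert_at /delete_at take_size_cat // drop_size_cat //.
    by rewrite -drop_nth // cat_take_drop eqxx.
  move=> a ne; case: eqP => // es; case/eqP: ne.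
  rewrite [in RHS]es /insert_at /delete_at take_size_cat // drop_size_cat //.
  by rewrite nth_cat tj ltnn subnn.
case: leqP => jt; rewrite ?mul0r // mul1r big1 // => a _.
case: eqP => // es; case/eqP: ne.
have tj : size (take j t) = j by rewrite size_takel.
rewrite es /insert_at /delete_at take_size_cat // drop_cat tj.
by rewrite ltnNge leqnSn /= subSnn drop1 /= cat_take_drop.
Qed.

Lemma mcoeff_bd_path xi s t :
  (bd_path xi s)@_t = ((1 < size s)%N && regular_path t)%:R *
    \sum_(j < size s) xi ^+ j * (delete_at j s == t)%:R.
Proof.
rewrite /bd_path; case: leqP => _; first by rewrite mcoeff0 mul0r.
rewrite raddf_sum mulr_sumr; apply: eq_bigr => j _ /=.
have [<-|ne] := eqVneq (delete_at j s) t.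
  by case: ifP => _; rewrite ?mcoeffUU ?mcoeff0 ?mul0r // !mul1r mulr1.
by rewrite !mulr0; case: ifP => _; rewrite ?mcoeff0 // mcoeffU (negbTE ne).
Qed.

Lemma sum_msupp v t : \sum_(s <- msupp v) v@_s * (s == t)%:R = v@_t.
Proof.
rewrite [in RHS](monalgE v) raddf_sum; apply: eq_bigr => s _ /=.
by rewrite mcoeffU mulr_natr.
Qed.

(* The faces of index [j] equal to [t] come from the sequences [t] with a vertex
   inserted at [j]. *)
Lemma mcoeff_bd xi v t : t != [::] ->
  (bd xi v)@_t = (regular_path t)%:R *
    \sum_(j < (size t).+1) xi ^+ j * \sum_(a : V) v@_(insert_at j a t).
Proof.
move=> t0; rewrite /bd raddf_sum /=.
pose F s j a : R[i] := v@_s * (s == insert_at j a t)%:R.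
(* Each coefficient on the right is expanded over the components of [v], so that both sides can be
   compared one component at a time. *)
under [in RHS]eq_bigr => j _ do under eq_bigr => a _ do rewrite -sum_msupp.
transitivity (\sum_(s <- msupp v) (regular_path t)%:R *
  \sum_(j < (size t).+1) xi ^+ j * \sum_(a : V) F s j a); last first.
  rewrite -mulr_sumr exchange_big /=; congr (_ * _); apply: eq_bigr => j _.
  by rewrite -mulr_sumr exchange_big.
apply: eq_bigr => s _; rewrite mcoeffZ mcoeff_bd_path /F.
have [es|ne] := eqVneq (size s) (size t).+1.
  rewrite -es.
  have -> : (1 < size s)%N by rewrite es ltnS lt0n size_eq0.
  rewrite /= mulrCA; congr (_ * _); rewrite mulr_sumr; apply: eq_bigr => j _.
  rewrite delete_at_eq // -ltnS -es ltn_ord mul1r mulrCA; congr (_ * _).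
  by rewrite mulr_sumr.
rewrite big1 => [|j _]; last first.
  case: eqP => [e|_]; last by rewrite mulr0.
  case/eqP: ne; rewrite -e size_cat size_take size_drop ltn_ord.
  by have := ltn_ord j; lia.
rewrite !mulr0 big1 ?mulr0 // => j _; rewrite big1 ?mulr0 // => a _.
case: eqP => [e|_]; last by rewrite mulr0.
case/eqP: ne; rewrite e size_cat /= size_take size_drop.
by case: ltnP => ?; have := ltn_ord j; lia.
Qed.

(** The case excluded in [mcoeff_bd]: only a 0-path has an empty face, and the boundary kills
    0-paths. *)
Lemma mcoeff_bd_nil xi v : (bd xi v)@_[::] = 0.
Proof.
rewrite /bd raddf_sum big1 // => s _ /=; rewrite mcoeffZ mcoeff_bd_path.
case: ltnP => s1; last by rewrite mul0r mulr0.
rewrite big1 ?mulr0 // => j _; case: eqP => [e|]; last by rewrite mulr0.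
by have := congr1 size e; rewrite size_cat size_take size_drop ltn_ord /=;
   have := ltn_ord j; lia.
Qed.

Lemma size_msupp_bd xi v n : (forall s, s \in msupp v -> size s = n) ->
  forall s, s \in msupp (bd xi v) -> s != [::] /\ (size s).+1 = n.
Proof.
move=> vn s; rewrite -mcoeff_neq0.
have [->|s0] := eqVneq s [::]; first by rewrite mcoeff_bd_nil eqxx.
move=> nz; split=> //; apply/eqP; apply: contraNT nz => ne.
rewrite mcoeff_bd // big1 ?mulr0 // => j _; rewrite big1 ?mulr0 // => a _.
apply/eqP; rewrite mcoeff_eq0; apply: contra ne => /vn <-.
by rewrite size_cat /= size_take size_drop; case: ltnP => ?;
   have := ltn_ord j; lia.
Qed.

Lemma mcoeff_bd2 xi v (x y : V) :
  (bd xi v)@_[:: x; y] = (x != y)%:R *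
    (\sum_a v@_[:: a; x; y] + xi * \sum_a v@_[:: x; a; y] +
     xi ^+ 2 * \sum_a v@_[:: x; y; a]).
Proof.
by rewrite mcoeff_bd // !big_ord_recl big_ord0 /= /insert_at /= mul1r andbT addr0 addrA.
Qed.

Lemma mcoeff_bd3 xi v (x y z : V) :
  (bd xi v)@_[:: x; y; z] = ((x != y) && (y != z))%:R *
    (\sum_a v@_[:: a; x; y; z] + xi * \sum_a v@_[:: x; a; y; z] +
     xi ^+ 2 * \sum_a v@_[:: x; y; a; z] + xi ^+ 3 * \sum_a v@_[:: x; y; z; a]).
Proof.
by rewrite mcoeff_bd // !big_ord_recl big_ord0 /= /insert_at /= mul1r andbT addr0 !addrA.
Qed.

End Boundary.

(** * Closure properties of linear spans *)

Section LinearSpan.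
Variables (K : pzRingType) (M : lmodType K) (X : set M).

Lemma linear_span0 : linear_span X 0.
Proof.
by exists 0, (fun=> 0), (fun=> 0); split=> [[]|] //; rewrite big_ord0.
Qed.

Lemma linear_span_gen c x : X x -> linear_span X (c *: x).
Proof.
by exists 1, (fun=> c), (fun=> x); split=> //; rewrite big_ord1.
Qed.

Lemma linear_spanD u v : linear_span X u -> linear_span X v -> linear_span X (u + v).
Proof.
move=> [m [c [x [Xx ->]]]] [n [d [y [Xy ->]]]].
exists (m + n)%N, (fun i => match fintype.split i with inl j => c j | inr j => d j end).
exists (fun i => match fintype.split i with inl j => x j | inr j => y j end); split.
  by move=> i; case: fintype.split.
rewrite big_split_ord /=; congr (_ + _); apply: eq_bigr => i _.
  by case: split_ordP => j /eqP; rewrite ?eq_lshift ?eq_lrshift // => /eqP ->.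
by case: split_ordP => j /eqP; rewrite ?eq_rshift ?eq_rlshift // => /eqP ->.
Qed.

Lemma linear_spanZ c u : linear_span X u -> linear_span X (c *: u).
Proof.
move=> [m [d [x [Xx ->]]]]; exists m, (fun i => c * d i), x; split=> //.
by rewrite scaler_sumr; apply: eq_bigr => i _; rewrite scalerA.
Qed.

Lemma linear_span_sum (I : finType) (F : I -> M) :
  (forall i, linear_span X (F i)) -> linear_span X (\sum_i F i).
Proof.
by move=> XF; apply: (big_ind (linear_span X)) => //;
   [exact: linear_span0 | exact: linear_spanD].
Qed.

End LinearSpan.

(** * Conditions that the first and second boundary impose on 3-chains *)

Section ThreePaths.
Variables (R : realType) (V : finType) (E : rel V).
Hypothesis E_irr : irreflexive E.
Implicit Types (xi : R[i]) (s t : seq V) (v w : {malg R[i][seq V]}).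

Lemma A_mcoeffP n v :
  A E n v <-> forall s, ~~ allowed_path E n s -> v@_s = 0.
Proof.
split=> [Av s|v0 s]; first by move=> /(contra (Av s)); exact: mcoeff_outdom.
by rewrite -mcoeff_neq0; apply: contraR => /v0 ->.
Qed.

Lemma A3_size v : A E 3 v -> forall s, s \in msupp v -> size s = 4.
Proof. by move=> Av s /Av /and3P[_ /eqP + _]; lia. Qed.

Lemma A3_mcoeff0 v a j k c : A E 3 v ->
  ~~ [&& E a j, E j k & E k c] -> v@_[:: a; j; k; c] = 0.
Proof. by move=> /A_mcoeffP Av n; apply: Av; rewrite /allowed_path /= andbT. Qed.

Lemma allowed3E (a j k c : V) :
  allowed_path E 3 [:: a; j; k; c] = [&& E a j, E j k & E k c].
Proof. by rewrite /allowed_path /= andbT. Qed.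

(** Components of the iterated boundary are nonempty of size [4 - q]: single vertices for [q = 3],
    and none at all for larger [q]. *)
Lemma A3_iter_bd xi v q : A E 3 v -> (3 <= q)%N -> A E (3 - q%:Z) (iter q (bd xi) v).
Proof.
move=> Av q3.
have sz n s : s \in msupp (iter n (bd xi) v) -> (size s + n = 4)%N.
  elim: n s => [|n IH] s /=; first by rewrite addn0; apply: A3_size.
  by case/(@size_msupp_bd _ _ _ _ (4 - n)) => [t /IH|_]; lia.
move=> s sq; have := sz _ _ sq.
move: sq; case: q q3 => [|q] // q3 /= /(@size_msupp_bd _ _ _ _ (4 - q)) [].
  by move=> t /sz; lia.
case: s => [|x [|y s]] //= _ _; last by lia.
by move=> e; rewrite /allowed_path /= andbT; lia.
Qed.

(* With [v] seen, for fixed end vertices, as a matrix in the two middle vertices: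
   the columns [b] with [e_{a,b,c}] of type N_w sum to zero, so do the rows, and
   so does the whole matrix if its end vertices are distinct and not adjacent. *)
Definition balanced v :=
  [/\ forall a b c, a != b -> ~~ E a b -> \sum_j v@_[:: a; j; b; c] = 0,
      forall a b c, b != c -> ~~ E b c -> \sum_k v@_[:: a; b; k; c] = 0 &
      forall a b, a != b -> ~~ E a b -> \sum_k \sum_j v@_[:: a; j; k; b] = 0].

(** Inserting a vertex before or after a non-allowed [[:: x; y; z]] keeps the missing edge, so only
    the two inner insertions contribute to its coefficient. If just one edge is missing, only the
    insertion between its ends survives: this is a column or a row sum. *)
Lemma A2_bdP xi v : xi != 0 -> A E 3 v ->
  (A E 2 (bd xi v) <->
   [/\ forall a b c, a != b -> ~~ E a b -> \sum_j v@_[:: a; j; b; c] = 0 &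
       forall a b c, b != c -> ~~ E b c -> \sum_k v@_[:: a; b; k; c] = 0]).
Proof.
move=> xi0 Av.
have coef x y z : x != y -> y != z -> ~~ (E x y && E y z) ->
    (bd xi v)@_[:: x; y; z] = xi * \sum_a v@_[:: x; a; y; z] +
                              xi ^+ 2 * \sum_a v@_[:: x; y; a; z].
  move=> xy yz nE; rewrite mcoeff_bd3 xy yz mul1r.
  rewrite (_ : \sum_a v@_[:: a; x; y; z] = 0) ?add0r; last first.
    by apply: big1 => a _; rewrite (A3_mcoeff0 Av) // (negbTE nE) andbF.
  rewrite (_ : \sum_a v@_[:: x; y; z; a] = 0) ?mulr0 ?addr0 //.
  by apply: big1 => a _; rewrite (A3_mcoeff0 Av) // andbA (negbTE nE).
split=> [/A_mcoeffP v0|[col row]].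
  split=> a b c ab nE.
    (* Without the edge from [b] to [c] the column has no nonzero entry; with it, [[:: a; b; c]] is
       a regular face that is not allowed. *)
    have [bc|nbc] := boolP (E b c); last first.
      by apply: big1 => j _; rewrite (A3_mcoeff0 Av) // (negbTE nbc) !andbF.
    have /eqP : (bd xi v)@_[:: a; b; c] = 0.
      by apply: v0; rewrite /allowed_path /= (negbTE nE).
    rewrite coef // ?(negbTE nE) //; last first.
      by apply: contraTneq bc => ->; rewrite E_irr.
    rewrite [X in _ + _ * X]big1 ?mulr0 ?addr0 => [|k _]; last first.
      by rewrite (A3_mcoeff0 Av) // (negbTE nE).
    by rewrite mulf_eq0 (negbTE xi0) => /eqP.
  have [eab|nab] := boolP (E a b); last first.
    by apply: big1 => j _; rewrite (A3_mcoeff0 Av) // (negbTE nab).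
  have /eqP : (bd xi v)@_[:: a; b; c] = 0.
    by apply: v0; rewrite /allowed_path /= (negbTE nE) !andbF.
  rewrite coef // ?(negbTE nE) ?andbF //; last first.
    by apply: contraTneq eab => ->; rewrite E_irr.
  rewrite [X in _ * X + _]big1 ?mulr0 ?add0r => [|k _]; last first.
    by rewrite (A3_mcoeff0 Av) // (negbTE nE) !andbF.
  by rewrite mulf_eq0 expf_eq0 (negbTE xi0) => /eqP.
apply/A_mcoeffP => s ns; apply/eqP; rewrite mcoeff_eq0; apply/negP.
move=> ss; have [_ /eqP sz] := size_msupp_bd (A3_size Av) ss.
move: ss ns sz; case: s => [|x [|y [|z [|? ?]]]] //= + + _.
rewrite /allowed_path /= andbT -mcoeff_neq0 => + nE.
have [->|xy] := eqVneq x y; first by rewrite mcoeff_bd3 eqxx mul0r eqxx.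
have [->|yz] := eqVneq y z; first by rewrite mcoeff_bd3 eqxx andbF mul0r eqxx.
rewrite coef //.
have -> : \sum_a v@_[:: x; a; y; z] = 0.
  have [Exy|/col -> //] := boolP (E x y); apply: big1 => a _.
  by move: nE; rewrite Exy /= => nE; rewrite (A3_mcoeff0 Av) // (negbTE nE) !andbF.
have -> : \sum_a v@_[:: x; y; a; z] = 0.
  have [Eyz|/row -> //] := boolP (E y z); apply: big1 => a _.
  by move: nE; rewrite Eyz andbT => nE; rewrite (A3_mcoeff0 Av) // (negbTE nE).
by rewrite !mulr0 addr0 eqxx.
Qed.

(** Rows and columns come from the first boundary by [A2_bdP]; the total comes from the second,
    where the factor [1 + xi] has to be cancelled. *)
Lemma Omega21P xi v : xi != 0 -> 1 + xi != 0 ->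
  (Omega21 E xi v <-> A E 3 v /\ balanced v).
Proof.
move=> xi0 xi1.
(* Only the faces [[:: x; m; y]] of [bd xi v] contribute. Among the four sums that give their
   coefficients, the outer two vanish by the row and column conditions, and each inner one is the
   total of the matrix, with weights [xi] and [xi ^+ 2]. *)
have bd2 x y : A E 3 v -> A E 2 (bd xi v) -> x != y -> ~~ E x y ->
    (bd xi (bd xi v))@_[:: x; y] =
      xi ^+ 2 * (1 + xi) * \sum_k \sum_j v@_[:: x; j; k; y].
  move=> Av Abv xy nE; have [col row] := (A2_bdP xi0 Av).1 Abv.
  have bv0 : forall t, ~~ allowed_path E 2 t -> (bd xi v)@_t = 0 by apply/A_mcoeffP.
  rewrite mcoeff_bd2 xy mul1r.
  rewrite [X in X + _ + _]big1 ?add0r => [|a _]; last first.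
    by rewrite bv0 // /allowed_path /= (negbTE nE) !andbF.
  rewrite [X in _ + _ * X]big1 ?mulr0 ?addr0 => [|a _]; last first.
    by rewrite bv0 // /allowed_path /= (negbTE nE).
  rewrite expr2 -!mulrA; congr (_ * _).
  transitivity (\sum_m (\sum_a v@_[:: a; x; m; y] +
      xi * \sum_a v@_[:: x; a; m; y] + xi ^+ 2 * \sum_a v@_[:: x; m; a; y] +
      xi ^+ 3 * \sum_a v@_[:: x; m; y; a])).
    apply: eq_bigr => m _; rewrite mcoeff_bd3.
    (* For [m = x] or [m = y] the face is irregular and has coefficient 0. The four sums vanish too:
       their sequences contain a loop or the missing edge from [x] to [y]. *)
    case: (eqVneq x m) => [<-|_]; last case: (eqVneq m y) => [->|_].
    - rewrite mul0r !big1 ?mulr0 ?addr0 // => a _; rewrite (A3_mcoeff0 Av) //.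
      + by rewrite (negbTE nE) andbF.
      + by rewrite E_irr.
      + by rewrite (negbTE nE) !andbF.
      + by rewrite E_irr andbF.
    - rewrite mul0r !big1 ?mulr0 ?addr0 // => a _; rewrite (A3_mcoeff0 Av) //.
      + by rewrite E_irr andbF.
      + by rewrite (negbTE nE).
      + by rewrite E_irr !andbF.
      + by rewrite (negbTE nE) andbF.
    by rewrite mul1r.
  rewrite !big_split /= -!mulr_sumr.
  rewrite exchange_big big1 ?add0r => [|i _]; last exact: row.
  rewrite [X in _ + _ * X]exchange_big [X in _ + _ * X]big1 => [|i _]; last exact: col.
  rewrite mulr0 addr0 (exchange_big _ _ _ _ _ (fun m a => v@_[:: x; m; a; y])) /=.
  by rewrite -mulrDl [RHS]mulrA mulrDr mulr1 -expr2.
have nz : xi ^+ 2 * (1 + xi) != 0 by rewrite mulf_neq0 // expf_neq0.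
split=> [[[Av A1v] [_ A2v]]|[Av [col row tot]]].
  split=> //; have [col row] := (A2_bdP xi0 Av).1 A2v.
  split=> // a b ab nE; apply/eqP; have := bd2 _ _ Av A2v ab nE.
  move/A_mcoeffP: A1v => /= -> => [/esym/eqP|].
    by rewrite mulf_eq0 (negbTE nz).
  by rewrite /allowed_path /= (negbTE nE) !(andbF, andFb).
have A2v : A E 2 (bd xi v) by apply/(A2_bdP xi0 Av).
suff A1v : A E 1 (bd xi (bd xi v)).
  by split; split; [exact: Av | exact: A1v | exact: Av | exact: A2v].
apply/A_mcoeffP => s ns; apply/eqP; rewrite mcoeff_eq0; apply/negP => ss.
have bsz t : t \in msupp (bd xi v) -> size t = 3.
  by move=> /(size_msupp_bd (A3_size Av))[_ []].
have [_ /eqP sz] := size_msupp_bd bsz ss.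
move: ss ns sz; case: s => [|x [|y [|? ?]]] //= + + _.
rewrite /allowed_path /= andbT -mcoeff_neq0 => + nE.
have [->|xy] := eqVneq x y; first by rewrite mcoeff_bd2 eqxx mul0r eqxx.
by rewrite bd2 // tot // mulr0 eqxx.
Qed.

(** The bound on [N] puts both 1 and 2 in the range of [q]; larger [q] impose nothing, by
    [A3_iter_bd]. *)
Lemma Omega_eq21 xi N : (3 <= N)%N -> Omega E xi N 3 = Omega21 E xi.
Proof.
move=> N3; apply/seteqP; split=> [v Ov|v [O2 O1] q /= /andP[q1 _]].
  by split; apply: Ov => /=; lia.
case: (leqP 3 q) => [q3|q3].
  by case: O1 => Av _; split; [exact: Av | exact: A3_iter_bd].
have [->|->] : q = 1 \/ q = 2 by lia.
  exact: O1.
exact: O2.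
Qed.

(** * Decomposition into minimal clusters *)

Section Span.
Variable xi : R[i].
Hypotheses (xi0 : xi != 0) (xi1 : 1 + xi != 0).

Lemma Omega21_lincomb (c : R[i]) v w :
  Omega21 E xi v -> Omega21 E xi w -> Omega21 E xi (v + c *: w).
Proof.
move=> /(Omega21P _ xi0 xi1)[Av [v1 v2 v3]] /(Omega21P _ xi0 xi1)[Aw [w1 w2 w3]].
apply/(Omega21P _ xi0 xi1); split.
  apply/A_mcoeffP => s ns; rewrite mcoeffD mcoeffZ.
  by move/A_mcoeffP: Av => ->//; move/A_mcoeffP: Aw => ->//; rewrite mulr0 addr0.
have sumE (F : V -> seq V) :
    \sum_j (v + c *: w)@_(F j) = \sum_j v@_(F j) + c * \sum_j w@_(F j).
  by rewrite mulr_sumr -big_split; apply: eq_bigr => j _; rewrite mcoeffD mcoeffZ.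
split=> a b.
- by move=> d ab nE; rewrite sumE v1 // w1 // mulr0 addr0.
- by move=> d ab nE; rewrite sumE v2 // w2 // mulr0 addr0.
- move=> ab nE; under eq_bigr => k _ do rewrite sumE.
  by rewrite big_split -mulr_sumr /= v3 // w3 // mulr0 addr0.
Qed.

Lemma Omega21_0 : Omega21 E xi 0.
Proof.
apply/(Omega21P _ xi0 xi1); split; first by move=> s; rewrite msupp0.
by split=> *; rewrite big1 // => k _; rewrite ?big1 // => *; rewrite mcoeff0.
Qed.

(** The block of [v] with end vertices [a] and [c]. On the empty sequence the defaults of [head] and
    [last] make both tests succeed, but it is no component of a chain in [A E 3]. *)
Definition with_ends (a c : V) (v : {malg R[i][seq V]}) : {malg R[i][seq V]} :=
  [malg s in msupp v => if (head a s == a) && (last c s == c) then v@_s else 0].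

Lemma mcoeff_with_ends a c v s :
  (with_ends a c v)@_s = if (head a s == a) && (last c s == c) then v@_s else 0.
Proof.
by rewrite mcoeffE; case: msuppP => //; case: ifP.
Qed.

(** Each sum in [balanced] runs over paths with fixed end vertices, so the restriction multiplies it
    by 0 or 1. *)
Lemma Omega21_with_ends a c v : Omega21 E xi v -> Omega21 E xi (with_ends a c v).
Proof.
move=> /(Omega21P _ xi0 xi1)[Av [v1 v2 v3]]; apply/(Omega21P _ xi0 xi1); split.
  apply/A_mcoeffP => s ns; rewrite mcoeff_with_ends.
  by move/A_mcoeffP: Av => ->//; case: ifP.
have E0 x j k y : (with_ends a c v)@_[:: x; j; k; y] =
    ((x == a) && (y == c))%:R * v@_[:: x; j; k; y].
  by rewrite mcoeff_with_ends /=; case: ifP; rewrite ?mul1r ?mul0r.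
split=> x y.
- move=> z xy nE; under eq_bigr => j _ do rewrite E0.
  by rewrite -mulr_sumr v1 ?mulr0.
- move=> z xy nE; under eq_bigr => j _ do rewrite E0.
  by rewrite -mulr_sumr v2 ?mulr0.
- move=> xy nE; under eq_bigr => j _ do under eq_bigr => k _ do rewrite E0.
  by under eq_bigr => j _ do rewrite -mulr_sumr; rewrite -mulr_sumr v3 ?mulr0.
Qed.

Lemma cluster_with_ends a c v : A E 3 v -> cluster E (with_ends a c v).
Proof.
move=> Av; split.
  apply/A_mcoeffP => s ns; rewrite mcoeff_with_ends.
  by move/A_mcoeffP: Av => ->//; case: ifP.
move=> i j k l i' j' k' l'; rewrite -!mcoeff_neq0 !mcoeff_with_ends /=.
case: ifP => [/andP[/eqP -> /eqP ->] _|]; rewrite ?eqxx //.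
by case: ifP => [/andP[/eqP -> /eqP ->]|]; rewrite ?eqxx.
Qed.

Lemma sum_with_ends v : A E 3 v -> v = \sum_a \sum_c with_ends a c v.
Proof.
move=> Av; apply/malgP => s; rewrite raddf_sum.
under eq_bigr => a _ do rewrite raddf_sum /=.
have [ss|] := boolP (s \in msupp v); last first.
  move=> /mcoeff_outdom v0; rewrite v0 big1 // => a _; rewrite big1 // => c _.
  by rewrite mcoeff_with_ends v0; case: ifP.
have := A3_size Av ss; case: s {ss} => [|a [|j [|k [|c [|? ?]]]]] // _.
rewrite (bigD1 a) //= (bigD1 c) //= mcoeff_with_ends /= !eqxx /=.
rewrite big1 => [|d /negbTE nd]; last by rewrite mcoeff_with_ends /= eq_sym nd andbF.
rewrite addr0 big1 ?addr0 // => b /negbTE nb; rewrite big1 // => d _.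
by rewrite mcoeff_with_ends /= eq_sym nb.
Qed.

Lemma cluster_sub v w : cluster E w -> (msupp v `<=` msupp w)%fset -> cluster E v.
Proof.
move=> [Aw cw] /fsubsetP vw; split=> [s /vw /Aw //|].
by move=> i j k l i' j' k' l' /vw h /vw h'; exact: cw h h'.
Qed.

(** Induction on the number of components. A nonzero cluster that is not minimal contains the
    support of a smaller [v] in [Omega21], and splits into a multiple of [v] and a remainder that
    also has fewer components. *)
Lemma cluster_span w : cluster E w -> Omega21 E xi w ->
  linear_span [set u | minimal_cluster E xi u] w.
Proof.
have [n le_n] := ubnP #|` msupp w|; elim: n => // n IH in w le_n *.
move=> cw Ow; have [->|w0] := eqVneq w 0; first exact: linear_span0.
have [[v [vw v0 Ov]]|nov] := pselect (exists v,
    [/\ (msupp v `<` msupp w)%fset, v != 0 & Omega21 E xi v]); last first.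
  rewrite -[w]scale1r; apply: linear_span_gen; split=> //; split=> // P _ Pw.
  by case=> v [vP v0 Ov]; apply: nov; exists v; split=> //; exact: fsub_proper_trans Pw.
have [s sv] : exists s, s \in msupp v.
  apply: contrapT => nos; case/eqP: v0; apply/malgP => s; rewrite mcoeff0.
  by apply: mcoeff_outdom; apply/negP => sv; apply: nos; exists s.
have vs0 : v@_s != 0 by rewrite mcoeff_neq0.
(* This [c] cancels the component [s] in [u]. *)
pose c := w@_s / v@_s; pose u := w + (- c) *: v.
have -> : w = u + c *: v by rewrite /u scaleNr subrK.
have vw' := fproper_sub vw.
have uw : (msupp u `<=` msupp w)%fset.
  apply/fsubsetP => t; apply: contraTT => tw.
  rewrite -mcoeff_eq0 mcoeffD mcoeffZ !mcoeff_outdom ?mulr0 ?addr0 //.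
  by apply: contra tw; exact: (fsubsetP vw').
have su : s \notin msupp u.
  by rewrite -mcoeff_eq0 mcoeffD mcoeffZ mulNr /c divfK // subrr.
have sw : s \in msupp w by exact: (fsubsetP vw').
apply: linear_spanD; last apply: linear_spanZ.
  apply: IH; last exact: Omega21_lincomb.
    apply: leq_trans (_ : #|` msupp w| <= n)%N => //.
    apply: fproper_ltn_card; rewrite fproperE uw; apply/negP => /fsubsetP wu.
    by case/negP: su; exact: wu.
  exact: cluster_sub uw.
apply: IH => //; last exact: cluster_sub vw'.
exact: leq_trans (fproper_ltn_card vw) _.
Qed.

Lemma Omega21_span :
  Omega21 E xi = linear_span [set w | minimal_cluster E xi w].
Proof.
apply/seteqP; split=> v.
  move=> Ov; have [Av _] := (Omega21P v xi0 xi1).1 Ov.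
  rewrite (sum_with_ends Av); do 2![apply: linear_span_sum => ?].
  by apply: cluster_span; [exact: cluster_with_ends | exact: Omega21_with_ends].
move=> [m [c [x [xM ->]]]]; apply: (big_ind (Omega21 E xi)) => [|u w Ou Ow|i _].
- exact: Omega21_0.
- by rewrite -[w]scale1r; exact: Omega21_lincomb.
- rewrite -[_ *: _]add0r; apply: Omega21_lincomb; first exact: Omega21_0.
  by case: (xM i) => _ [].
Qed.

(** Supplies the second intermediate vertex that excludes type W for the outer faces of a
    component. *)
Lemma sum0_mate (I : finType) (F : I -> R[i]) i :
  \sum_j F j = 0 -> F i != 0 -> exists2 j, j != i & F j != 0.
Proof.
move=> sF Fi; apply: contrapT => no; case/eqP: Fi.
rewrite (bigD1 i) //= big1 ?addr0 // in sF => j ji.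
by apply/eqP; apply: contrapT => /negP Fj; apply: no; exists j.
Qed.

(** * Image-types of the components of balanced chains and of minimal clusters *)

Section ImageTypes.
Variables (w : {malg R[i][seq V]}) (a c : V).
Hypotheses (Aw : A E 3 w) (bw : balanced w).

Lemma componentE j k : [:: a; j; k; c] \in msupp w -> [/\ E a j, E j k & E k c].
Proof. by move=> /Aw; rewrite allowed3E => /and3P. Qed.

Lemma adj_neq (x y : V) : E x y -> (x == y) = false.
Proof. by move=> e; apply: contraTF e => /eqP ->; rewrite E_irr. Qed.

(** The face is allowed. If its ends are distinct and not adjacent, column [k] sums to zero, and a
    second nonzero entry of that column gives another vertex between [a] and [k]. *)
Lemma type2_first j k : [:: a; j; k; c] \in msupp w ->
  type2 E a j k = if E a k || (a == k) then typeT else typeS.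
Proof.
move=> jk; have [aj ejk kc] := componentE jk.
rewrite /type2 (adj_neq aj) (adj_neq ejk) aj ejk /=; case: ifP => // /norP[nak ak].
case: bw => col _ _; have := col a k c ak nak; move: jk; rewrite -mcoeff_neq0.
move=> jk /sum0_mate/(_ jk)[j' j'j]; rewrite mcoeff_neq0 => /componentE[aj' j'k _].
by case: existsP => // -[]; exists j'; rewrite j'j aj' j'k.
Qed.

(** The argument of [type2_first], applied to the row of [j]. *)
Lemma type2_last j k : [:: a; j; k; c] \in msupp w ->
  type2 E j k c = if E j c || (j == c) then typeT else typeS.
Proof.
move=> jk; have [aj ejk kc] := componentE jk.
rewrite /type2 (adj_neq kc) (adj_neq ejk) kc ejk /=; case: ifP => // /norP[njc jc].
case: bw => _ row _; have := row a j c jc njc; move: jk; rewrite -mcoeff_neq0.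
move=> jk /sum0_mate/(_ jk)[k' k'k]; rewrite mcoeff_neq0 => /componentE[_ jk' k'c].
by case: existsP => // -[]; exists k'; rewrite k'k jk' k'c.
Qed.

(** A middle face that is allowed or irregular has type T here, because of the relation between [a]
    and [c]; otherwise it has type N_w. *)
Lemma image_type_near j k : E a c || (a == c) -> [:: a; j; k; c] \in msupp w ->
  image_type E a j k c =
    match E j c || (j == c), E a k || (a == k) with
    | true, true => gamma9
    | true, false => gamma4
    | false, true => gamma1
    | false, false => gamma7
    end.
Proof.
move=> ac jk; have [aj ejk kc] := componentE jk.
rewrite /image_type (type2_first jk) (type2_last jk) /type2 ac aj kc.
rewrite (adj_neq aj) (adj_neq kc) /= orbF andbT.
by case: (a == k); case: (j == c); case: (E a k); case: (E j c).
Qed.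

(** All allowed 2-paths from [a] to [c] share one type [t], which depends only on whether there are
    two intermediate vertices. *)
Lemma image_type_far j k : ~~ E a c -> a != c -> [:: a; j; k; c] \in msupp w ->
  let t := if [exists y, exists z, [&& y != z, E a y, E y c, E a z & E z c]]
           then typeS else typeW in
  image_type E a j k c =
    match E j c, E a k with
    | true, true => (typeT, t, t, typeT)
    | true, false => (typeT, typeNw, t, typeS)
    | false, true => (typeS, t, typeNw, typeT)
    | false, false => gamma7
    end.
Proof.
move=> nac ac jk t; have [aj ejk kc] := componentE jk.
(* Either of [k = a] and [j = c] would yield an edge from [a] to [c]. *)
have ak : (a == k) = false by apply: contraNF nac => /eqP ->.
have jc : (j == c) = false by apply: contraNF nac => /eqP <-.
have midT y : E a y -> E y c -> type2 E a y c = t.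
  move=> ay yc; rewrite /type2 (adj_neq ay) (adj_neq yc) ay yc (negbTE nac) (negbTE ac) /= /t.
  case: existsP => [[z /and3P[zy az zc]]|no]; last case: existsP => // -[x].
    by case: existsP => // -[]; exists y; apply/existsP; exists z; rewrite eq_sym zy ay yc az.
  case/existsP => z /and5P[xz ax xc az zc]; case: no.
  (* Of the two distinct vertices [x] and [z], at least one differs from [y]. *)
  have [xy|xy] := eqVneq x y; last by exists x; rewrite xy ax xc.
  by exists z; rewrite -xy eq_sym xz az zc.
rewrite /image_type (type2_first jk) (type2_last jk) ak jc !orbF.
have typek : type2 E a k c = if E a k then t else typeNw.
  by case: ifP => eak; [exact: midT | rewrite /type2 ak (adj_neq kc) eak].
have typej : type2 E a j c = if E j c then t else typeNw.
  by case: ifP => ejc; [exact: midT | rewrite /type2 jc (adj_neq aj) ejc andbF].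
by rewrite typek typej; case: (E j c); case: (E a k).
Qed.

End ImageTypes.

(** Conditions in [balanced] arise only at pairs that are distinct and not adjacent. No relevant
    pair of this path is of that kind, so the path enters no constrained sum. *)
Lemma Omega21_path (a j k c : V) :
  E a j -> E j k -> E k c -> E a c || (a == c) -> E a k || (a == k) ->
  E j c || (j == c) -> Omega21 E xi << [:: a; j; k; c] >>.
Proof.
move=> aj jk kc ac ak jc; apply/(Omega21P _ xi0 xi1); split.
  move=> s; rewrite -mcoeff_neq0 mcoeffU; case: (_ =P s) => [<- _|_]; last by rewrite eqxx.
  by rewrite allowed3E aj jk.
have z x y : x != y -> ~~ E x y -> ~~ (E x y || (x == y)).
  by move=> xy nE; rewrite negb_or nE.
split=> x y.
- move=> d xy /(z _ _ xy) nE; apply: big1 => i _; rewrite mcoeffU.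
  by case: eqP => // -[ex _ ey _]; rewrite -ex -ey ak in nE.
- move=> d xy /(z _ _ xy) nE; apply: big1 => i _; rewrite mcoeffU.
  by case: eqP => // -[_ ex _ ey]; rewrite -ex -ey jc in nE.
- move=> xy /(z _ _ xy) nE; apply: big1 => i _; apply: big1 => l _; rewrite mcoeffU.
  by case: eqP => // -[ex _ _ ey]; rewrite -ex -ey ac in nE.
Qed.

Lemma minimal_msupp1 w s : minimal E xi w -> s \in msupp w ->
  Omega21 E xi << s >> -> msupp w = [fset s]%fset.
Proof.
move=> [_ _ min] sw Os; apply/eqP; rewrite eq_sym.
have s1w : ([fset s] `<=` msupp w)%fset by rewrite fsub1set.
apply: contrapT => /negP ne; apply: (min [fset s]%fset).
- by apply/fset0Pn; exists s; rewrite inE.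
- by rewrite fproperEneq ne.
exists << s >>; split=> //; first exact: msuppU_le.
by rewrite monalgU_eq0 oner_eq0.
Qed.

Lemma minimal_cluster_types w : minimal_cluster E xi w ->
  exists2 T, type_groups T & forall i j k l : V, [:: i; j; k; l] \in msupp w ->
    T (image_type E i j k l).
Proof.
move=> [cw mw]; have [Ow _ _] := mw.
have [Aw bw] := (Omega21P w xi0 xi1).1 Ow.
have [a [c comp]] : exists a c, forall i j k l,
    [:: i; j; k; l] \in msupp w -> i = a /\ l = c.
  have [[s sw]|no] := pselect (exists s, s \in msupp w).
    have := A3_size Aw sw; case: s sw => [|a [|j [|k [|c [|? ?]]]]] // sw _.
    by exists a, c => i' j' k' l' sw'; exact: (cw.2 _ _ _ _ _ _ _ _ sw' sw).
  have [_ w0 _] := mw; case/eqP: w0; apply/malgP => s; rewrite mcoeff0.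
  by apply: mcoeff_outdom; apply/negP => sw; apply: no; exists s.
suff [T TT Tw] : exists2 T, type_groups T & forall j k, [:: a; j; k; c] \in msupp w ->
    T (image_type E a j k c).
  by exists T => // i j k l s; have [? ?] := comp _ _ _ _ s; subst; exact: Tw.
have [ac|/norP[nac ac]] := boolP (E a c || (a == c)).
  have [[j [k [jk jc ak]]]|no9] := pselect (exists j k,
      [/\ [:: a; j; k; c] \in msupp w, E j c || (j == c) & E a k || (a == k)]).
    exists group5; first by right.
    have [aj ejk kc] := componentE Aw jk.
    (* By minimality, a component that enters no constrained sum is the whole cluster. *)
    have ms := minimal_msupp1 mw jk (Omega21_path aj ejk kc ac ak jc).
    move=> j' k'; rewrite ms inE => /eqP[-> ->].
    by rewrite (image_type_near Aw bw ac jk) jc ak.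
  exists group1; first by do 4!left.
  move=> j k jk; rewrite (image_type_near Aw bw ac jk).
  case: ifPn => jc; case: ifPn => ak.
  - by case: no9; exists j, k.
  - by left; right.
  - by left; left.
  - by right.
(* This is the condition that makes the common type of allowed middle faces S rather than W; it
   separates [group2] from [group3]. *)
pose two := [exists y, exists z, [&& y != z, E a y, E y c, E a z & E z c]].
have [h|h] := boolP two.
  exists group2; first by do 3!left; right.
  move=> j k jk; rewrite (image_type_far Aw bw nac ac jk) /= -/two h.
  case: ifP => jc; case: ifP => ak; rewrite /group2 /=; tauto.
exists group3; first by do 2!left; right.
move=> j k jk; rewrite (image_type_far Aw bw nac ac jk) /= -/two (negbTE h).
case: ifP => jc; case: ifP => ak; rewrite /group3 /=; try tauto.
(* A single intermediate vertex cannot be both [j] and [k], as [j -> k]. *)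
have [aj ejk kc] := componentE Aw jk.
case/negP: h; apply/existsP; exists j; apply/existsP; exists k.
by rewrite adj_neq // aj jc ak kc.
Qed.

End Span.
End ThreePaths.

(** If [xi = -1], then [xi ^+ 2 = 1] and [N] divides 2. *)
Lemma primitive_root_neqN1 (K : numDomainType) (N : nat) (xi : K) :
  (3 <= N)%N -> N.-primitive_root xi -> 1 + xi != 0.
Proof.
move=> N3 prim; rewrite addrC addr_eq0; apply/eqP => xiN1.
have := prim_order_dvd prim 2; rewrite xiN1 sqrrN expr1n eqxx => /dvdn_leq.
by move=> /(_ isT); lia.
Qed.

Theorem corollary3p9p1 (R : realType) (N : nat) (xi : R[i])
    (V : finType) (E : rel V) :
  (3 <= N)%N -> N.-primitive_root xi -> irreflexive E ->
  [/\ Omega E xi N 3 = Omegaq E xi 3 1 `&` Omegaq E xi 3 2,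
      Omega E xi N 3 = linear_span [set w | minimal_cluster E xi w] &
      forall w : {malg R[i][seq V]}, minimal_cluster E xi w ->
        exists2 T, type_groups T &
          forall i j k l : V, [:: i; j; k; l] \in msupp w ->
            T (image_type E i j k l)].
Proof.
move=> N3 prim E_irr; have xi1 := primitive_root_neqN1 N3 prim.
have xi0 : xi != 0.
  apply/eqP => x0; have /eqP := prim_expr_order prim.
  by rewrite x0 expr0n gtn_eqF ?(leq_trans _ N3) // eq_sym oner_eq0.
rewrite (Omega_eq21 _ _ N3); split.
- by rewrite setIC.
- exact: Omega21_span.
- exact: minimal_cluster_types.
Qed.
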